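(* Let $\mathcal F$ be the feasible region of the mathematical program with switching constraints (MPSC) $$\min f(z)\quad\text{s.t.}\quad g(z)\le 0,\ h(z)=0,\ G_i(z)H_i(z)=0,\ i=1,\dots,m,$$ and let $z^*\in\mathcal F$ be such that MPSC directional quasi-normality holds at $z^*$. Then the MPSC local error bound holds in a neighborhood of $z^*$, i.e. there exist a neighborhood $V(z^* )$ of $z^*$ and $\alpha>0$ such that $$\operatorname{dist}_{\mathcal F}(z)\le\alpha\left(\sum_{i=1}^p\max\{g_i(z),0\}+\sum_{j=1}^q|h_j(z)|+\sum_{i=1}^m\min\{|G_i(z)|,|H_i(z)|\}\right)\quad\forall z\in V(z^* ).$$
   Context: Setting: $f:\mathbb R^n\to\mathbb R$, $g:\mathbb R^n\to\mathbb R^p$, $h:\mathbb R^n\to\mathbb R^q$, $G=(G_1,\dots,G_m)$, $H=(H_1,\dots,H_m):\mathbb R^n\to\mathbb R^m$ are continuously differentiable; gradients of scalar functions are column vectors and $\nabla$ of a vector-valued map is its Jacobian. $\operatorname{dist}_{\mathcal F}(z)$ is the distance from $z$ to $\mathcal F$ with respect to an arbitrary norm on $\mathbb R^n$. Index sets at $z^*\in\mathcal F$: $\mathcal I_g^*=\{i: g_i(z^* )=0\}$; $\mathcal I_G^*=\{i: G_i(z^* )=0,H_i(z^* )\ne0\}$; $\mathcal I_H^*=\{i: G_i(z^* )\neq0,H_i(z^* )=0\}$; $\mathcal I_{GH}^*=\{i: G_i(z^* )=H_i(z^* )=0\}$. Linearization cone $L_{\mathcal F}^{\rm lin}(z^*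 )$: all $d\in\mathbb R^n$ with $\nabla g_i(z^* )^Td\le0$ ($i\in\mathcal I_g^*$), $\nabla h_j(z^* )^Td=0$ ($j=1,\dots,q$), $\nabla G_i(z^* )^Td=0$ ($i\in\mathcal I_G^*$), $\nabla H_i(z^* )^Td=0$ ($i\in\mathcal I_H^*$), $(\nabla G_i(z^* )^Td)(\nabla H_i(z^* )^Td)=0$ ($i\in\mathcal I_{GH}^*$). For $d\in L_{\mathcal F}^{\rm lin}(z^* )$: $\mathcal I_g^*(d)=\{i\in\mathcal I_g^*:\nabla g_i(z^* )^Td=0\}$; $\mathcal I_G^*(d)=\{i\in\mathcal I_{GH}^*:\nabla G_i(z^* )^Td=0,\nabla H_i(z^* )^Td\ne0\}$; $\mathcal I_H^*(d)=\{i\in\mathcal I_{GH}^*:\nabla G_i(z^* )^Td\ne0,\nabla H_i(z^* )^Td=0\}$; $\mathcal I_{GH}^*(d)=\{i\in\mathcal I_{GH}^*:\nabla G_i(z^* )^Td=\nabla H_i(z^* )^Td=0\}$. MPSC quasi-normality in direction $d\in L_{\mathcal F}^{\rm lin}(z^* )$ holds at $z^*$ if there is no $(\lambda^g,\lambda^h,\lambda^G,\lambda^H)\ne0$ such that: (i) $0=\nabla g(z^* )^T\lambda^g+\nabla h(z^* )^T\lambda^h+\nabla G(z^* )^T\lambda^G+\nabla H(z^* )^T\lambda^H$; (ii) $\lambda_i^g\ge0$ for $i\in\mathcal I_g^*(d)$, $\lambda_i^g=0$ for $i\notin\mathcal I_g^*(d)$, $\lambda_i^H=0$ for $i\in\mathcal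 I_G^*\cup\mathcal I_G^*(d)$, $\lambda_i^G=0$ for $i\in\mathcal I_H^*\cup\mathcal I_H^*(d)$, $\lambda_i^G\lambda_i^H=0$ for $i\in\mathcal I_{GH}^*(d)$; (iii) there are sequences $d^k\to d$ and $t_k\downarrow0$ such that for all $k$: $\lambda_i^gg_i(z^*+t_kd^k)>0$ if $\lambda_i^g\ne0$, $\lambda_i^hh_i(z^*+t_kd^k)>0$ if $\lambda_i^h\ne0$, $\lambda_i^GG_i(z^*+t_kd^k)>0$ if $\lambda_i^G\neq0$, $\lambda_i^HH_i(z^*+t_kd^k)>0$ if $\lambda_i^H\ne0$. MPSC directional quasi-normality holds at $z^*$ if MPSC quasi-normality holds at $z^*$ in all directions $d\in L_{\mathcal F}^{\rm lin}(z^* )$. *)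

(* Defs.v *)
From HB Require Import structures.
From mathcomp Require Import all_boot all_order all_algebra.
From mathcomp Require Import all_classical all_reals all_analysis.

Set Implicit Arguments.
Unset Strict Implicit.
Unset Printing Implicit Defensive.

Import Order.TTheory GRing.Theory Num.Theory.
Import numFieldNormedType.Exports.

Local Open Scope ring_scope.

(* Points of R^n are row vectors. The Jacobian 'J F z of the library acts on
   row vectors from the right: it is the n x p matrix whose i-th column is the
   gradient of F_i at z, i.e., the transpose of the textbook Jacobian.        *)

Definition continuously_differentiable (R : realType) (n p : nat)
    (F : 'rV[R]_n -> 'rV[R]_p) : Prop :=
  (forall z, differentiable F z) /\ continuous (fun z => 'J F z).

(* The scalar product of the gradient of F_i at z with d. *)
Definition dgrad (R : realType) (n p : nat) (F : 'rV[R]_n -> 'rV[R]_p)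
    (z d : 'rV[R]_n) (i : 'I_p) : R :=
  (d *m 'J F z) 0 i.

Record is_norm (R : realType) (n : nat) (N : 'rV[R]_n -> R) : Prop := IsNorm {
  is_norm_triangle : forall x y, N (x + y) <= N x + N y;
  is_norm_homogeneous : forall a x, N (a *: x) = `|a| * N x;
  is_norm_definite : forall x, N x = 0 -> x = 0 }.

Definition dist (R : realType) (n : nat) (N : 'rV[R]_n -> R)
    (F : set 'rV[R]_n) (z : 'rV[R]_n) : R :=
  inf [set N (z - y) | y in F]%classic.

(* min f(z)  s.t.  g(z) <= 0,  h(z) = 0,  G_i(z) H_i(z) = 0 for i < m *)
Record mpsc (R : realType) (n p q m : nat) := MPSC {
  objf : 'rV[R]_n -> R;
  gfun : 'rV[R]_n -> 'rV[R]_p;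
  hfun : 'rV[R]_n -> 'rV[R]_q;
  Gfun : 'rV[R]_n -> 'rV[R]_m;
  Hfun : 'rV[R]_n -> 'rV[R]_m }.

Section MPSC.
Context {R : realType} {n p q m : nat} (P : mpsc R n p q m).
Implicit Types z d : 'rV[R]_n.

Local Notation f := (objf P).
Local Notation g := (gfun P).
Local Notation h := (hfun P).
Local Notation G := (Gfun P).
Local Notation H := (Hfun P).

Definition mpsc_C1 : Prop :=
  [/\ continuously_differentiable (fun z => \row_(_ < 1) f z),
      continuously_differentiable g,
      continuously_differentiable h,
      continuously_differentiable G &
      continuously_differentiable H].

Definition feasible : set 'rV[R]_n :=
  [set z | [/\ forall i, g z 0 i <= 0,
               forall j, h z 0 j = 0 &
               forall i, G z 0 i * H z 0 i = 0]]%classic.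

Definition Ig z : {set 'I_p} := [set i | g z 0 i == 0].
Definition IG z : {set 'I_m} := [set i | (G z 0 i == 0) && (H z 0 i != 0)].
Definition IH z : {set 'I_m} := [set i | (G z 0 i != 0) && (H z 0 i == 0)].
Definition IGH z : {set 'I_m} := [set i | (G z 0 i == 0) && (H z 0 i == 0)].

Definition lin_cone z : set 'rV[R]_n :=
  [set d | [/\ forall i, i \in Ig z -> dgrad g z d i <= 0,
               forall j, dgrad h z d j = 0,
               forall i, i \in IG z -> dgrad G z d i = 0,
               forall i, i \in IH z -> dgrad H z d i = 0 &
               forall i, i \in IGH z -> dgrad G z d i * dgrad H z d i = 0]
  ]%classic.

Definition Igd z d : {set 'I_p} := [set i in Ig z | dgrad g z d i == 0].
Definition IGd z d : {set 'I_m} :=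
  [set i in IGH z | (dgrad G z d i == 0) && (dgrad H z d i != 0)].
Definition IHd z d : {set 'I_m} :=
  [set i in IGH z | (dgrad G z d i != 0) && (dgrad H z d i == 0)].
Definition IGHd z d : {set 'I_m} :=
  [set i in IGH z | (dgrad G z d i == 0) && (dgrad H z d i == 0)].

Definition stationary z (lg : 'rV[R]_p) (lh : 'rV[R]_q) (lG lH : 'rV[R]_m) :
    Prop :=
  lg *m ('J g z)^T + lh *m ('J h z)^T + lG *m ('J G z)^T + lH *m ('J H z)^T
    = 0.

Definition sign_conditions z d (lg : 'rV[R]_p) (lG lH : 'rV[R]_m) : Prop :=
  [/\ forall i, i \in Igd z d -> 0 <= lg 0 i,
      forall i, i \notin Igd z d -> lg 0 i = 0,
      forall i, i \in IG z :|: IGd z d -> lH 0 i = 0,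
      forall i, i \in IH z :|: IHd z d -> lG 0 i = 0 &
      forall i, i \in IGHd z d -> lG 0 i * lH 0 i = 0].

(* t_k \downarrow 0 is read as t_k > 0 and t_k -> 0. *)
Definition sequential_condition z (d : 'rV[R]_n)
    (lg : 'rV[R]_p) (lh : 'rV[R]_q) (lG lH : 'rV[R]_m) : Prop :=
  exists (dk : nat -> 'rV[R]_n) (t : nat -> R),
    [/\ (dk @ \oo --> d)%classic,
        (forall k, 0 < t k),
        (t @ \oo --> (0 : R))%classic &
        forall k, let zk := z + t k *: dk k in
          [/\ forall i, lg 0 i != 0 -> 0 < lg 0 i * g zk 0 i,
              forall j, lh 0 j != 0 -> 0 < lh 0 j * h zk 0 j,
              forall i, lG 0 i != 0 -> 0 < lG 0 i * G zk 0 i &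
              forall i, lH 0 i != 0 -> 0 < lH 0 i * H zk 0 i]].

Definition quasi_normal_in z d : Prop :=
  ~ exists (lg : 'rV[R]_p) (lh : 'rV[R]_q) (lG lH : 'rV[R]_m),
    [/\ (lg, lh, lG, lH) <> (0, 0, 0, 0),
        stationary z lg lh lG lH,
        sign_conditions z d lg lG lH &
        sequential_condition z d lg lh lG lH].

Definition directionally_quasi_normal z : Prop :=
  forall d, lin_cone z d -> quasi_normal_in z d.

Definition residual z : R :=
  \sum_(i < p) Num.max (g z 0 i) 0 + \sum_(j < q) `|h z 0 j|
    + \sum_(i < m) Num.min `|G z 0 i| `|H z 0 i|.

Definition local_error_bound (N : 'rV[R]_n -> R) (zs : 'rV[R]_n) : Prop :=
  exists (V : set 'rV[R]_n) (alpha : R),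
    [/\ nbhs zs V, 0 < alpha &
        forall z, V z -> dist N feasible z <= alpha * residual z].

End MPSC.

(* Main.v *)
(* Only the direction d = 0 is needed: any sequence z_k -> z* can be written
   z* + t_k d_k with t_k -> 0 and d_k -> 0, so quasi-normality in direction 0 is
   the classical, non-directional condition. For each S, requiring G_i = 0 on S
   and H_i = 0 off S gives a branch of the feasible set; at a point z the
   residual equals that of the branch S = {i : |G_i(z)| <= |H_i(z)|}, so it
   suffices to bound the distance branch by branch. Splitting each equality into two
   inequalities, a branch is a system phi_k <= 0.
   Let psi be the Euclidean norm of the vector of positive parts phi_k^+. Where
   psi > 0, its gradient is the combination of the gradients of the phi_k with
   the unit weights phi_k^+ / psi; if it came arbitrarily close to 0 near z*, a
   limit of these weights would be a multiplier excluded by quasi-normality.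
   Hence |grad psi| > c near z* off the branch, and a minimiser y of
   psi + c |z - .| on a small ball around z* satisfies psi(y) = 0, which gives
   c |z - y| <= psi(z). *)
Require Import Defs.
From mathcomp Require Import all_boot all_order all_algebra.
From mathcomp Require Import all_classical all_reals all_analysis.
From mathcomp Require Import ring lra.

Set Implicit Arguments.
Unset Strict Implicit.
Unset Printing Implicit Defensive.

Import Order.TTheory GRing.Theory Num.Theory.
Import numFieldNormedType.Exports.

Local Open Scope classical_set_scope.
Local Open Scope ring_scope.

(** * Inequality systems: quasi-normality and combinations of gradients *)

Definition C1_grad (R : realType) (n : nat)
    (f : 'rV[R]_n -> R) (D : 'rV[R]_n -> 'cV[R]_n) : Prop :=
  [/\ continuous f, continuous D & forall z u,
      h^-1 * (f (h *: u + z) - f z) @[h --> 0^'] --> (u *m D z) 0 0].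

(** Complementarity is implicit: if [phi i] is continuous and [phi i zs < 0], no positive values
    occur near [zs], so [l i] cannot be positive. *)
Definition quasi_normal_ineq (R : realType) (n : nat) (I : finType)
    (phi : I -> 'rV[R]_n -> R) (D : I -> 'rV[R]_n -> 'cV[R]_n)
    (zs : 'rV[R]_n) : Prop :=
  forall l : I -> R, (forall i, 0 <= l i) -> \sum_i l i *: D i zs = 0 ->
    (forall e, 0 < e ->
       exists2 z, `|zs - z| < e & forall i, 0 < l i -> 0 < phi i z) ->
    forall i, l i = 0.

Lemma cvg_sumr (R : realType) (V : normedModType R) (I : finType) (T : Type)
    (F : set_system T) (f : I -> T -> V) (l : I -> V) :
  Filter F -> (forall i, f i x @[x --> F] --> l i) ->
  \sum_i f i x @[x --> F] --> \sum_i l i.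
Proof.
by move=> FF fl; apply: cvg_big => // -[a b]; exact: add_continuous.
Qed.

Lemma ultra_fmap (T U : Type) (f : T -> U) (F : set_system T) :
  UltraFilter F -> UltraFilter (f @ F).
Proof.
move=> FU; split; first exact: fmap_proper_filter.
move=> G GF FG; apply/seteqP; split => // A GA.
have [//|nA] := in_ultra_setVsetC (f @^-1` A) FU.
have /FG/(filterI GA)/filter_ex[x []//] : (f @ F) (~` A) by [].
Qed.

Lemma gradient_lower_bound (R : realType) (n : nat) (I : finType)
    (phi : I -> 'rV[R]_n -> R) (D : I -> 'rV[R]_n -> 'cV[R]_n)
    (zs : 'rV[R]_n) :
  (forall i, continuous (D i)) -> quasi_normal_ineq phi D zs ->
  exists c d : R, [/\ 0 < c, 0 < d & forall y (l : I -> R),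
    `|zs - y| < d -> (forall i, 0 <= l i) -> \sum_i l i ^+ 2 = 1 ->
    (forall i, 0 < l i -> 0 < phi i y) -> c < `|\sum_i l i *: D i y| ].
Proof.
move=> Dcont QN; apply: contrapT => bad.
have /choice[yl ylP] : forall k : nat, exists yl : 'rV[R]_n * (I -> R),
    [/\ `|zs - yl.1| < k.+1%:R^-1, (forall i, 0 <= yl.2 i),
      \sum_i yl.2 i ^+ 2 = 1, (forall i, 0 < yl.2 i -> 0 < phi i yl.1) &
      `|\sum_i yl.2 i *: D i yl.1| <= k.+1%:R^-1].
  move=> k; apply: contrapT => noyl; apply: bad.
  exists k.+1%:R^-1, k.+1%:R^-1; split; rewrite ?invr_gt0//.
  move=> y l yd l0 l1 lphi.
  by rewrite ltNge; apply/negP => lD; apply: noyl; exists (y, l).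
pose y k := (yl k).1; pose lam k := (yl k).2.
have invn0 : k.+1%:R^-1 @[k --> \oo] --> (0 : R) by exact: cvg_harmonic.
(* An ultrafilter replaces the extraction of subsequences: along it all weights, lying in the
   compact [[0, 1]], converge simultaneously. *)
have [G [GU oG]] := ultraFilterLemma eventually_filter.
have invG0 : k.+1%:R^-1 @[k --> G] --> (0 : R) by move=> A /invn0; exact: oG.
have yG : y k @[k --> G] --> zs.
  apply/cvgrPdist_lt => e e0; have /cvgr0Pnorm_lt/(_ _ e0) := invG0.
  apply: filterS => k; rewrite ger0_norm ?invr_ge0//; apply: lt_trans.
  by have [] := ylP k.
have lamG i : exists li : R, lam k i @[k --> G] --> li.
  have := @segment_compact R 0 1; rewrite compact_ultra => /(_ (lam^~ i @ G)).
  case=> [||li [_ lamli]]; last by exists li.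
    exact: ultra_fmap.
  apply: (@filterE _ G _ (lam^~ i @^-1` _)) => k /=.
  rewrite in_itv/=; have [_ l0 l1 _ _] := ylP k.
  have : lam k i ^+ 2 <= 1.
    rewrite -l1 (bigD1 i)//= lerDl sumr_ge0// => j _.
    by rewrite sqr_ge0.
  by rewrite l0/= expr_le1//; apply: l0.
have /choice[l lG] := lamG.
have l0 i : 0 <= l i.
  apply: (ler_cvg_to (cvg_cst 0) (lG i)).
  by apply: filterE => k; have [_ + _ _ _] := ylP k; apply.
have l1 : \sum_i l i ^+ 2 = 1.
  have /cvg_unique : \sum_i lam k i ^+ 2 @[k --> G] --> \sum_i l i ^+ 2.
    by apply: cvg_sumr => i; rewrite expr2; apply: cvgM.
  apply => //; rewrite (_ : (fun _ => _) = cst 1); first exact: cvg_cst.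
  by apply/funext => k; have [] := ylP k.
have lD : \sum_i l i *: D i zs = 0.
  have /cvg_unique : \sum_i lam k i *: D i (y k) @[k --> G]
      --> \sum_i l i *: D i zs.
    by apply: cvg_sumr => i; apply: cvgZ => //; apply: cvg_comp yG (Dcont i zs).
  apply => //; apply/cvgr0Pnorm_lt => e e0.
  have /cvgr0Pnorm_lt/(_ _ e0) := invG0.
  apply: filterS => k; rewrite ger0_norm ?invr_ge0//; apply: le_lt_trans.
  by have [] := ylP k.
suff /(QN l l0 lD) lz : forall e, 0 < e ->
    exists2 z, `|zs - z| < e & forall i, 0 < l i -> 0 < phi i z.
  move: l1 (@oner_neq0 R) => <-; rewrite big1 ?eqxx// => i _.
  by rewrite lz expr0n.
move=> e e0.
(* There are finitely many indices, so a single [k] makes [lam k i] positive wherever the limit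
   [l i] is. *)
have : \forall k \near G, forall i, 0 < l i -> 0 < lam k i.
  apply: filter_forall => i; have [li0|li0] := ltP 0 (l i).
    by by apply: filterS (cvgr_gt _ (lG i) _ li0).
  by apply: filterE.
move=> posG; have /cvgrPdist_lt/(_ _ e0) yGe := yG.
have [k [yk lk]] := @filter_ex _ G _ _ (filterI yGe posG).
by exists (y k) => // i /lk; have [_ _ _ + _] := ylP k; apply.
Qed.

(** * Slope of the Euclidean violation *)

(** The squared positive part has a 2-Lipschitz derivative, twice the positive part; this is its
    quadratic upper bound at [a]. *)
Lemma sqr_maxr0_le (R : realType) (a b : R) :
  Num.max b 0 ^+ 2
    <= Num.max a 0 ^+ 2 + 2 * Num.max a 0 * (b - a) + (b - a) ^+ 2.
Proof.
have := sqr_ge0 b; have := sqr_ge0 a; have := sqr_ge0 (b - a).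
case: (ltP a 0) => a0; case: (ltP b 0) => b0; rewrite !expr2 => ab2 a2 b2.
- by lra.
- by have := mulr_ge0_le0 b0 (ltW a0); lra.
- by lra.
- by lra.
Qed.

Lemma sqrt_sum_sqr_le (R : realType) (I : finType) (a : I -> R) :
  (forall i, 0 <= a i) -> Num.sqrt (\sum_i a i ^+ 2) <= \sum_i a i.
Proof.
move=> a0; have suma0 : 0 <= \sum_i a i by exact: sumr_ge0.
rewrite -[leRHS](ger0_norm suma0) -sqrtr_sqr ler_sqrt ?sqr_ge0//.
rewrite expr2 mulr_suml; apply: ler_sum => i _.
by rewrite expr2 ler_wpM2l// (bigD1 i)//= lerDl sumr_ge0.
Qed.

(** The norm is the largest absolute entry, so it suffices to test with the signed unit vector [u]
    that turns this entry into its negated modulus. *)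
Lemma norm_cV_le (R : realType) (n : nat) (X : 'cV[R]_n) (c : R) : 0 <= c ->
  (forall u : 'rV[R]_n, - (c * `|u|) <= (u *m X) 0 0) -> `|X| <= c.
Proof.
move=> c0 Xu; have [->//|X0] := eqVneq `|X| 0.
have [[i k] /= XE] := mx_norm_neq0 X0; rewrite ord1 in XE.
pose u : 'rV[R]_n := - Num.sg (X i 0) *: delta_mx 0 i.
have u1 : `|u| <= 1.
  rewrite -[leLHS]/(mx_norm u) mx_normrE; apply: bigmax_le => // -[j l] _ /=.
  rewrite !mxE normrM normrN normr_sg normr_nat -natrM (ler_nat R _ 1).
  by apply: leq_trans (leq_mul (leq_b1 _) (leq_b1 _)) _.
have := Xu u; rewrite -scalemxAl -rowE !mxE mulNr lerN2.
rewrite -normrEsg -[`|X|]/(mx_norm X) XE => /le_trans; apply.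
by rewrite ler_piMr.
Qed.

(** Squared positive parts stay differentiable where a constraint vanishes, while a plain sum of
    positive parts would have kinks there. *)
Definition violation (R : realType) (n : nat) (I : finType)
    (phi : I -> 'rV[R]_n -> R) (z : 'rV[R]_n) : R :=
  Num.sqrt (\sum_i Num.max (phi i z) 0 ^+ 2).

(** The vector in the conclusion is the gradient of the violation at [y], and the last hypothesis
    says that the violation falls at rate at most [c] around [y]. The squared violation is expanded
    along each ray [h *: u + y]. *)
Lemma gradient_upper_bound (R : realType) (n : nat) (I : finType)
    (phi : I -> 'rV[R]_n -> R) (D : I -> 'rV[R]_n -> 'cV[R]_n)
    (y : 'rV[R]_n) (c r : R) :
  (forall i, C1_grad (phi i) (D i)) -> 0 <= c -> 0 < r ->
  0 < violation phi y ->
  (forall y', `|y' - y| < r ->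
     violation phi y - c * `|y' - y| <= violation phi y') ->
  `|\sum_i (Num.max (phi i y) 0 / violation phi y) *: D i y| <= c.
Proof.
move=> phiC1 c0 r0 A0 ymin; apply: norm_cV_le => // u.
set A := violation phi y in A0 ymin *.
pose W i h := h^-1 * (phi i (h *: u + y) - phi i y).
have WD i : W i h @[h --> 0^'+] --> (u *m D i y) 0 0.
  by apply: cvg_dnbhs_at_right; have [_ _] := phiC1 i; apply.
(* Summing [sqr_maxr0_le] over the constraints bounds the squared violation at [h *: u + y] by
   [A ^+ 2 + h * Q h]. *)
pose Q h := \sum_i 2 * Num.max (phi i y) 0 * W i h + h * \sum_i W i h ^+ 2.
have QD : Q h @[h --> 0^'+] -->
    \sum_i 2 * Num.max (phi i y) 0 * (u *m D i y) 0 0.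
  rewrite -[X in _ --> X]addr0.
  rewrite -[X in _ + X](mul0r (\sum_i (u *m D i y) 0 0 ^+ 2)).
  apply: cvgD; first by apply: cvg_sumr => i; apply: cvgM => //; exact: cvg_cst.
  apply: cvgM; first by apply: cvg_at_right_filter; exact: cvg_id.
  by apply: cvg_sumr => i; rewrite expr2; exact: cvgM.
suff : - (2 * A * (c * `|u|)) <=
    \sum_i 2 * Num.max (phi i y) 0 * (u *m D i y) 0 0.
  rewrite mulmx_sumr summxE => uD.
  under eq_bigr do rewrite -scalemxAr mxE.
  rewrite -(@ler_pM2l _ (2 * A)) ?mulr_gt0// mulrN (le_trans uD)// mulr_sumr.
  apply: ler_sum => i _; rewrite le_eqVlt; apply/predU1P; left; field.
  by rewrite gt_eqF.
apply: (ler_cvg_to (cvg_cst _) QD).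
have ru0 : 0 < r / (`|u| + 1) by rewrite divr_gt0// ltr_wpDl.
near=> h.
have h0 : 0 < h by [].
have hu : h * `|u| < r.
  have : h < r / (`|u| + 1) by near: h; exact: nbhs_right_lt.
  rewrite ltr_pdivlMr ?ltr_wpDl// => /(le_lt_trans _); apply.
  by rewrite ler_pM2l// lerDl.
have := ymin (h *: u + y); rewrite addrK normrZ gtr0_norm// => /(_ hu) Ah.
have A2 : A ^+ 2 = \sum_i Num.max (phi i y) 0 ^+ 2.
  by rewrite sqr_sqrtr// sumr_ge0// => i _; exact: sqr_ge0.
have B2 : violation phi (h *: u + y) ^+ 2
    <= A ^+ 2 + h * Q h.
  rewrite sqr_sqrtr; last by rewrite sumr_ge0// => i _; exact: sqr_ge0.
  rewrite A2 /Q mulrDr !mulr_sumr addrA -!big_split/=; apply: ler_sum => i _.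
  apply: le_trans (sqr_maxr0_le (phi i y) _) _.
  by rewrite le_eqVlt; apply/predU1P; left; rewrite /W; field; rewrite gt_eqF.
rewrite -(ler_pM2l h0).
(* With [B] the violation at the moved point, [B^2 >= 2 A B - A^2] allows the lower bound [Ah] on
   [B] to be used without squaring it, as its sign is unknown. *)
have := sqr_ge0 (violation phi (h *: u + y) - A).
have := ler_wpM2l (ltW A0) Ah.
move: B2; set B := violation _ _; lra.
Unshelve. all: by end_near.
Qed.

(** * Error bound for an inequality system *)

Lemma error_bound_ineq (R : realType) (n : nat) (I : finType)
    (phi : I -> 'rV[R]_n -> R) (D : I -> 'rV[R]_n -> 'cV[R]_n)
    (zs : 'rV[R]_n) :
  (forall i, C1_grad (phi i) (D i)) -> (forall i, phi i zs <= 0) ->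
  quasi_normal_ineq phi D zs ->
  exists c e : R, [/\ 0 < c, 0 < e & forall z, `|zs - z| < e ->
    exists2 y, forall i, phi i y <= 0 &
      `|z - y| <= c * \sum_i Num.max (phi i z) 0].
Proof.
move=> phiC1 phizs QN.
have Dcont i : continuous (D i) by have [] := phiC1 i.
have [c [d [c0 d0 lowD]]] := gradient_lower_bound Dcont QN.
(* Since [zs] solves the system, the minimiser [y] is no farther from [z] than [zs] is. With both
   distances below [d / 4], it lies strictly inside the ball of radius [d / 2]. *)
exists c^-1, (d / 4); split; rewrite ?invr_gt0 ?divr_gt0// => z zsz.
have d20 : 0 < d / 2 by rewrite divr_gt0.
pose A : set 'rV[R]_n := closed_ball zs (d / 2).
have AE y : A y <-> `|zs - y| <= d / 2.
  by rewrite /A closed_ballE ?divr_gt0.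
have vcont : continuous (violation phi).
  move=> y; apply: continuous_comp; last exact: sqrt_continuous.
  have maxc i : Num.max (phi i w) 0 @[w --> y] --> Num.max (phi i y) 0.
    apply: (@continuous_max R _ (phi i) (cst 0)).
      by have [phic _ _] := phiC1 i; exact: phic.
    exact: cst_continuous.
  apply: (@cvg_sumr R R I _ (nbhs y)) => i.
  by rewrite expr2; apply: cvgM.
have viol0 y : (forall i, phi i y <= 0) -> violation phi y = 0.
  move=> phiy; rewrite /violation big1 ?sqrtr0// => i _.
  by rewrite max_r// expr0n.
have [||| y] := @EVT_min_rV R n (fun y => violation phi y + c * `|z - y|) A.
- by exists zs; apply/AE; rewrite subrr normr0 divr_ge0// ltW.
- apply: bounded_closed_compact; last exact: closed_ball_closed.
  exists (`|zs| + d / 2); split; first exact: num_real.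
  move=> M /ltW ltM y /AE zsy; apply: le_trans ltM.
  by rewrite -[y](subKr zs) (le_trans (ler_normB _ _))// lerD2l.
- apply: continuous_subspaceT => w.
  apply: (@cvgD _ _ _ (nbhs w) _ (violation phi)); first exact: vcont.
  apply: (@cvgM _ _ (nbhs w)); first exact: cvg_cst.
  apply: (@cvg_norm _ _ _ (nbhs w)).
  by apply: (@cvgB _ _ _ (nbhs w)); [exact: cvg_cst|exact: cvg_id].
move=> _ yminA.
have ymin w : `|zs - w| <= d / 2 ->
    violation phi y + c * `|z - y| <= violation phi w + c * `|z - w|.
  by move=> /AE Aw; apply: yminA; rewrite inE.
have yz : `|z - y| <= `|zs - z|.
  have := ymin zs; rewrite subrr normr0 => /(_ (ltW d20)).
  rewrite (viol0 zs)// add0r (distrC z zs) => yzs.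
  by rewrite -(ler_pM2l c0) (le_trans _ yzs)// lerDr sqrtr_ge0.
have zsy : `|zs - y| < d / 2.
  apply: le_lt_trans (ler_distD z _ _) _.
  by rewrite (splitr (d / 2)) -mulrA -invfM -natrM ltrD// (le_lt_trans yz).
have [v0|v0] := leP (violation phi y) 0.
  exists y.
    move=> i; have : Num.max (phi i y) 0 ^+ 2 <= 0.
      apply: le_trans (_ : _ <= \sum_i Num.max (phi i y) 0 ^+ 2) _.
        by rewrite (bigD1 i)//= lerDl sumr_ge0// => j _; exact: sqr_ge0.
      by rewrite -sqrtr_eq0 eq_le v0 sqrtr_ge0.
    by rewrite real_exprn_even_le0 ?num_real//= => /eqP <-; rewrite le_max lexx.
  rewrite ler_pdivlMl//.
  have /ymin : `|zs - z| <= d / 2.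
    by rewrite (le_trans (ltW zsz))// ler_pM2l// lef_pV2 ?posrE ?ler_nat.
  rewrite subrr normr0 mulr0 addr0 => yzle.
  apply: le_trans (sqrt_sum_sqr_le _); last first.
    by move=> i; rewrite le_max lexx orbT.
  by apply: le_trans yzle; rewrite lerDr sqrtr_ge0.
have : `|\sum_i (Num.max (phi i y) 0 / violation phi y) *: D i y| <= c.
  (* The radius is the distance left from [y] to the boundary of the ball, so minimality applies to
     every [y']. *)
  apply: (@gradient_upper_bound _ _ _ _ _ _ _ (d / 2 - `|zs - y|)) => //.
  - exact: ltW.
  - by rewrite subr_gt0.
  move=> y' y'y; have /ymin : `|zs - y'| <= d / 2.
    apply: le_trans (ler_distD y _ _) _.
    by rewrite (distrC y) -lerBrDl ltW.
  have : c * `|z - y'| <= c * (`|z - y| + `|y' - y|).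
    by rewrite ler_pM2l// (distrC y') ler_distD.
  lra.
rewrite leNgt => /negP[]; apply: lowD.
- by apply: lt_trans zsy _; rewrite gtr_pMr// invf_lt1// ltr1n.
- by move=> i; rewrite divr_ge0 ?le_max ?lexx ?orbT// ltW.
- under eq_bigr do rewrite expr_div_n.
  rewrite -mulr_suml -[X in X / _]sqr_sqrtr ?divff// ?expf_eq0 ?gt_eqF//.
  by rewrite sumr_ge0// => i _; exact: sqr_ge0.
- move=> i; apply: contraTT; rewrite -!leNgt => phiy.
  by rewrite max_r// mul0r.
Qed.

(** * Branches of the switching system as inequality systems *)

Lemma C1_grad_component (R : realType) (n p : nat)
    (F : 'rV[R]_n -> 'rV[R]_p) (i : 'I_p) :
  continuously_differentiable F ->
  C1_grad (fun z => F z 0 i) (fun z => col i ('J F z)).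
Proof.
move=> [dF cJ]; split.
- move=> z; apply: (@continuous_comp _ _ _ F (fun M : 'rV[R]_p => M 0 i)).
    exact: differentiable_continuous.
  exact: coord_continuous.
- move=> z; apply/(@cvgrPdist_lt _ _ _ (nbhs z)) => e e0.
  have /(@cvgrPdist_lt _ _ _ (nbhs z))/(_ _ e0) := cJ z; apply: filterS => w.
  apply: le_lt_trans.
  rewrite -[leLHS]/(mx_norm _) mx_normrE; apply: bigmax_le => // -[j k] _ /=.
  rewrite -[leRHS]/(mx_norm _) mx_normrE.
  by apply: (bigmax_sup (j, i)) => //=; rewrite !mxE.
move=> z u; have dFz := @diff_derivable _ _ _ F z u (dF z).
have -> : (u *m col i ('J F z)) 0 0 = ('D_u F z) 0 i.
  by rewrite deriveEjacobian// !mxE; apply: eq_bigr => k _; rewrite mxE.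
apply: cvg_trans (cvg_comp _ _ dFz (@coord_continuous R 1 p 0 i ('D_u F z))).
by apply: near_eq_cvg; apply: nearW => h; rewrite /= !mxE.
Qed.

Lemma C1_gradZ (R : realType) (n : nat) (a : R)
    (f : 'rV[R]_n -> R) (D : 'rV[R]_n -> 'cV[R]_n) :
  C1_grad f D -> C1_grad (fun z => a * f z) (fun z => a *: D z).
Proof.
move=> [cf cD fD]; split.
- by move=> z; apply: (@cvgM _ _ (nbhs z)); [exact: cvg_cst|exact: cf].
- by move=> z; apply: (@cvgZ _ _ _ (nbhs z)); [exact: cvg_cst|exact: cD].
move=> z u; rewrite -scalemxAr mxE.
under eq_fun do rewrite -mulrBr mulrCA.
by apply: cvgM; [exact: cvg_cst|exact: fD].
Qed.

(** Multipliers [a] of [x <= 0] and [b] of [- x <= 0] cannot both be positive, as [x] would have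
    both signs. Hence no cancellation occurs in the equality multiplier [a - b]. *)
Lemma signed_multiplier (R : realType) (a b x : R) :
  0 <= a -> 0 <= b -> (0 < a -> 0 < x) -> (0 < b -> 0 < - x) ->
  (a - b != 0 -> 0 < (a - b) * x) /\ (a - b = 0 -> a = 0 /\ b = 0).
Proof.
rewrite [_ <= a]le_eqVlt [_ <= b]le_eqVlt.
case/orP => [/eqP<-|a0]; case/orP => [/eqP<-|b0] ax bx.
- by rewrite subr0 eqxx.
- by rewrite sub0r mulNr -mulrN mulr_gt0 ?bx//; split=> //; lra.
- by rewrite subr0 mulr_gt0 ?ax//; split=> //; lra.
- by have := ax a0; have := bx b0; lra.
Qed.

Section Branch.
Context {R : realType} {n p q m : nat} (P : mpsc R n p q m) (S : {set 'I_m}).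

Local Notation branch_index := ('I_p + 'I_q * bool + 'I_m * bool)%type.

Definition branch (k : branch_index) (z : 'rV[R]_n) : R :=
  match k with
  | inl (inl i) => gfun P z 0 i
  | inl (inr (j, b)) => (-1) ^+ b * hfun P z 0 j
  | inr (i, b) =>
      (-1) ^+ b * (if i \in S then Gfun P z 0 i else Hfun P z 0 i)
  end.

Definition branch_grad (k : branch_index) (z : 'rV[R]_n) : 'cV[R]_n :=
  match k with
  | inl (inl i) => col i ('J (gfun P) z)
  | inl (inr (j, b)) => (-1) ^+ b *: col j ('J (hfun P) z)
  | inr (i, b) => (-1) ^+ b *:
      (if i \in S then col i ('J (Gfun P) z) else col i ('J (Hfun P) z))
  end.

Lemma branch_C1 : mpsc_C1 P -> forall k, C1_grad (branch k) (branch_grad k).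
Proof.
case=> _ gC1 hC1 GC1 HC1 [[i|[j b]]|[i b]] /=.
- exact: C1_grad_component.
- by apply: C1_gradZ; exact: C1_grad_component.
- by apply: C1_gradZ; case: (i \in S); exact: C1_grad_component.
Qed.

Lemma sum_branch_index (V : nmodType) (F : branch_index -> V) :
  \sum_k F k = \sum_i F (inl (inl i))
    + \sum_j (F (inl (inr (j, false))) + F (inl (inr (j, true))))
    + \sum_i (F (inr (i, false)) + F (inr (i, true))).
Proof.
rewrite big_sumType big_sumType /=; congr (_ + _ + _).
- rewrite (eq_bigr (fun k => F (inl (inr (k.1, k.2))))); last by move=> [].
  rewrite -(pair_bigA _ (fun j b => F (inl (inr (j, b))))) /=.
  by apply: eq_bigr => j _; rewrite big_bool addrC.
- rewrite (eq_bigr (fun k => F (inr (k.1, k.2)))); last by move=> [].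
  rewrite -(pair_bigA _ (fun i b => F (inr (i, b)))) /=.
  by apply: eq_bigr => j _; rewrite big_bool addrC.
Qed.

Lemma max_opp_norm (x : R) :
  Num.max ((-1) ^+ false * x) 0 + Num.max ((-1) ^+ true * x) 0 = `|x|.
Proof.
rewrite expr0 expr1 mul1r mulN1r.
rewrite (maxC x) (maxC (- x)); have [x0|x0] := leP 0 x.
  by rewrite ger0_norm// max_l ?oppr_le0// addr0.
by rewrite ltr0_norm// max_r ?oppr_ge0 ?add0r// ltW.
Qed.

Lemma sum_branch_violation z :
  \sum_k Num.max (branch k z) 0 =
  \sum_(i < p) Num.max (gfun P z 0 i) 0 + \sum_(j < q) `|hfun P z 0 j|
    + \sum_(i < m) `|if i \in S then Gfun P z 0 i else Hfun P z 0 i|.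
Proof.
rewrite sum_branch_index; congr (_ + _ + _).
  by apply: eq_bigr => j _; exact: max_opp_norm.
by apply: eq_bigr => i _; exact: max_opp_norm.
Qed.

Lemma branch_eq z :
  (forall k, branch k z <= 0) ->
  [/\ forall i, gfun P z 0 i <= 0, forall j, hfun P z 0 j = 0 &
      forall i, (if i \in S then Gfun P z 0 i else Hfun P z 0 i) = 0].
Proof.
move=> zle; split=> [i|j|i]; first exact: (zle (inl (inl i))).
- have := zle (inl (inr (j, false))); have := zle (inl (inr (j, true))).
  by rewrite /= expr0 expr1; lra.
- have := zle (inr (i, false)); have := zle (inr (i, true)).
  by rewrite /= expr0 expr1; lra.
Qed.

Lemma branch_feasible z : (forall k, branch k z <= 0) -> feasible P z.
Proof.
move=> /branch_eq[zg zh zGH]; split=> // i.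
by have := zGH i; case: ifP => _ ->; rewrite ?mul0r ?mulr0.
Qed.

End Branch.

(** * Quasi-normality of the branches from the direction 0 *)

Lemma dgrad0 (R : realType) (n p : nat) (F : 'rV[R]_n -> 'rV[R]_p) z i :
  dgrad F z 0 i = 0.
Proof. by rewrite /dgrad mul0mx mxE. Qed.

Lemma lin_cone0 (R : realType) (n p q m : nat) (P : mpsc R n p q m)
    (zs : 'rV[R]_n) : lin_cone P zs 0.
Proof.
by split=> [i _|j|i _|i _|i _]; rewrite ?dgrad0 ?mul0r ?lexx.
Qed.

(** The scale [t] is free: points chosen within [t k ^+ 2] of [zs] give directions of norm at most
    [t k]. *)
Lemma cvg_to_direction0 (R : realType) (n : nat) (zs : 'rV[R]_n)
    (A : set 'rV[R]_n) :
  (forall e, 0 < e -> exists2 z, `|zs - z| < e & A z) ->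
  exists (dk : nat -> 'rV[R]_n) (t : nat -> R),
    [/\ dk @ \oo --> (0 : 'rV[R]_n), forall k, 0 < t k,
        t @ \oo --> (0 : R) & forall k, A (zs + t k *: dk k)].
Proof.
move=> Azs; pose t k : R := k.+1%:R^-1.
have t0 k : 0 < t k by rewrite invr_gt0.
have /choice[z zP] : forall k, exists z, `|zs - z| < t k ^+ 2 /\ A z.
  by move=> k; have [z ? ?] := Azs _ (exprn_gt0 2 (t0 k)); exists z.
have tcvg : t @ \oo --> (0 : R) by exact: cvg_harmonic.
exists (fun k => (t k)^-1 *: (z k - zs)), t; split=> // [|k].
  apply/cvgr0Pnorm_lt => e e0; have /cvgr0Pnorm_lt/(_ _ e0) := tcvg.
  apply: filterS => k; apply: le_lt_trans.
  rewrite normrZ distrC normfV ler_pdivrMl ?normr_gt0 ?gt_eqF// gtr0_norm//.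
  by rewrite -expr2 ltW//; have [] := zP k.
by rewrite scalerA divff ?gt_eqF// scale1r addrC subrK; have [] := zP k.
Qed.

(* The Jacobians are abstracted: comparing two of them by conversion diverges. *)
Lemma multipliers_sum (R : realType) (n p q m : nat) (S : {set 'I_m})
    (lg : 'I_p -> R) (lh : 'I_q -> bool -> R) (lK : 'I_m -> bool -> R)
    (Jg : 'M[R]_(n, p)) (Jh : 'M[R]_(n, q)) (JG JH : 'M[R]_(n, m)) :
  ((\row_i lg i) *m Jg^T
   + (\row_j (lh j false - lh j true)) *m Jh^T
   + (\row_i if i \in S then lK i false - lK i true else 0) *m JG^T
   + (\row_i if i \in S then 0 else lK i false - lK i true) *m JH^T)^T =
  \sum_i lg i *: col i Jg
  + \sum_j (lh j false *: ((-1) ^+ false *: col j Jh)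
           + lh j true *: ((-1) ^+ true *: col j Jh))
  + \sum_i (lK i false *: ((-1) ^+ false *:
              (if i \in S then col i JG else col i JH))
           + lK i true *: ((-1) ^+ true *:
              (if i \in S then col i JG else col i JH))).
Proof.
apply/colP => k; rewrite !mxE -addrA -big_split !summxE.
congr (_ + _ + _); apply: eq_bigr => i _; rewrite !mxE //=.
  by ring.
by case: (i \in S); rewrite !mxE; ring.
Qed.

(** The two multipliers of an equality are subtracted, and the result goes to [lG] on [S] and to
    [lH] off [S], so that their products vanish at every index. In direction 0 the sets [IGd] and
    [IHd] are empty and [Igd] is all of [Ig]. *)
Lemma quasi_normal_branch (R : realType) (n p q m : nat)
    (P : mpsc R n p q m) (S : {set 'I_m}) (zs : 'rV[R]_n) :
  mpsc_C1 P -> feasible P zs -> (forall k, branch P S k zs <= 0) ->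
  quasi_normal_in P zs 0 ->
  quasi_normal_ineq (branch P S) (branch_grad P S) zs.
Proof.
move=> PC1 zsF zsS QN l l0 lD lseq; apply: contrapT => lN0; apply: QN.
have [zsg zsh zsGH] := branch_eq zsS.
pose lg := \row_i l (inl (inl i)).
pose lh := \row_j (l (inl (inr (j, false))) - l (inl (inr (j, true)))).
pose lK i := l (inr (i, false)) - l (inr (i, true)).
pose lG := \row_i if i \in S then lK i else 0.
pose lH := \row_i if i \in S then 0 else lK i.
have signed (k0 k1 : 'I_p + 'I_q * bool + 'I_m * bool) (x : 'rV[R]_n -> R) z :
    (forall w, branch P S k0 w = x w) -> (forall w, branch P S k1 w = - x w) ->
    (forall k, 0 < l k -> 0 < branch P S k z) ->
    (l k0 - l k1 != 0 -> 0 < (l k0 - l k1) * x z) /\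
    (l k0 - l k1 = 0 -> l k0 = 0 /\ l k1 = 0).
  move=> k0x k1x lz; apply: signed_multiplier => //.
    by rewrite -k0x; exact: lz.
  by rewrite -k1x; exact: lz.
have signed_h j z := @signed (inl (inr (j, false))) (inl (inr (j, true)))
  (fun z => hfun P z 0 j) z (fun=> mul1r _) (fun=> mulN1r _).
have signed_K i z := @signed (inr (i, false)) (inr (i, true))
  (fun z => if i \in S then Gfun P z 0 i else Hfun P z 0 i) z
  (fun=> mul1r _) (fun=> mulN1r _).
exists lg, lh, lG, lH; split.
- move=> [lg0 lh0 lG0 lH0]; apply: lN0 => k.
  (* One point with the sign conditions, at any radius, excludes cancellation: a vanishing
     difference then means that both multipliers vanish. *)
  have [z _ lz] := lseq 1 ltr01.
  case: k => [[i|[j b]]|[i b]].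
  + by have /rowP/(_ i) := lg0; rewrite !mxE.
  + have /rowP/(_ j) := lh0; rewrite !mxE => /((signed_h j z lz).2)[].
    by case: b.
  + have : lK i = 0.
      have /rowP/(_ i) := lG0; have /rowP/(_ i) := lH0; rewrite !mxE.
      by case: ifP.
    move=> /((signed_K i z lz).2)[].
    by case: b.
- move: lD; rewrite sum_branch_index.
  rewrite -(multipliers_sum S (fun i => l (inl (inl i)))
    (fun j b => l (inl (inr (j, b)))) (fun i b => l (inr (i, b)))
    ('J (gfun P) zs) ('J (hfun P) zs) ('J (Gfun P) zs) ('J (Hfun P) zs)).
  by move=> /(congr1 trmx); rewrite trmxK trmx0.
- split.
  + by move=> i _; rewrite mxE.
  (* An inactive [g i] is negative near [zs], whereas a positive multiplier would require nearby
     points where it is positive. *)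
  + move=> i; rewrite !inE dgrad0 eqxx andbT => gi0; rewrite mxE; apply/eqP.
    rewrite eq_le l0 andbT leNgt; apply/negP => li.
    have gi : gfun P zs 0 i < 0 by rewrite lt_neqAle gi0 zsg.
    have [gc _ _] := branch_C1 S PC1 (inl (inl i)).
    have /nbhs_ballP[e /= e0 eg] : nbhs zs [set w | gfun P w 0 i < 0].
      exact: (@cvgr_lt _ _ (nbhs zs) _ _ _ (gc zs) _ gi).
    have [z zsz lz] := lseq e e0.
    have := lz _ li; rewrite ltNge => /negP; apply; apply: ltW; apply: eg.
    by rewrite -ball_normE.
  (* As [H i] is nonzero at [zs], a branch through [zs] must impose [G i = 0], so [i] is in [S]. The
     next case is symmetric. *)
  + move=> i; rewrite !inE !dgrad0 !eqxx /= andbF orbF => /andP[_ Hi].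
    rewrite mxE; case: ifP => // iS; have := zsGH i; rewrite iS => Hi0.
    by rewrite Hi0 eqxx in Hi.
  + move=> i; rewrite !inE !dgrad0 !eqxx /= andbF orbF => /andP[Gi _].
    rewrite mxE; case: ifP => // iS; have := zsGH i; rewrite iS => Gi0.
    by rewrite Gi0 eqxx in Gi.
  + by move=> i _; rewrite !mxE; case: ifP => _; rewrite ?mulr0 ?mul0r.
have [dk [t [dk0 t0 tcvg At]]] := @cvg_to_direction0 _ _ zs
  [set z | forall k, 0 < l k -> 0 < branch P S k z] lseq.
exists dk, t; split=> // k; have lz := At k; split=> i; rewrite !mxE.
- move=> li; have li0 : 0 < l (inl (inl i)) by rewrite lt_neqAle eq_sym li l0.
  by rewrite mulr_gt0// (lz (inl (inl i))).
- exact: (signed_h i _ lz).1.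
- by have := (signed_K i _ lz).1; case: ifP => // _; rewrite eqxx.
- by have := (signed_K i _ lz).1; case: ifP => // _; rewrite eqxx.
Qed.

(** * Branchwise bounds and passage to an arbitrary norm *)

Lemma branch_error_bound (R : realType) (n p q m : nat)
    (P : mpsc R n p q m) (S : {set 'I_m}) (zs : 'rV[R]_n) :
  mpsc_C1 P -> feasible P zs -> quasi_normal_in P zs 0 ->
  exists a : R, 0 < a /\ \forall z \near zs, exists2 y, feasible P y &
    `|z - y| <= a * \sum_k Num.max (branch P S k z) 0.
Proof.
move=> PC1 zsF QN.
have [zsS|] := pselect (forall k, branch P S k zs <= 0).
  have [a [e [a0 e0 aE]]] := error_bound_ineq (branch_C1 S PC1) zsS
    (quasi_normal_branch PC1 zsF zsS QN).
  exists a; split => //; apply/nbhs_ballP; exists e => //= z.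
  rewrite -ball_normE /= => /aE[y yS yz].
  by exists y => //; exact: branch_feasible yS.
move=> /existsNP[k /negP]; rewrite -ltNge => phik.
(* Here [zs] is off the branch: constraint [k] keeps over half its value near [zs], and [zs] itself
   serves as [y] within distance 1. *)
exists (branch P S k zs / 2)^-1; split; first by rewrite invr_gt0 divr_gt0.
have [kc _ _] := branch_C1 S PC1 k.
have k2 : branch P S k zs / 2 < branch P S k zs.
  by rewrite ltr_pdivrMr// ltr_pMr// ltr1n.
have near_k : nbhs zs [set w | branch P S k zs / 2 < branch P S k w].
  exact: (@cvgr_gt _ _ (nbhs zs) _ _ _ (kc zs) _ k2).
apply: filterS2 near_k (nbhsx_ballx zs 1 ltr01) => z /= kz.
rewrite -ball_normE /= distrC => /ltW zzs.
exists zs => //; apply: le_trans zzs _.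
rewrite ler_pdivlMl ?divr_gt0// mulr1 (le_trans (ltW kz))//.
rewrite (bigD1 k)//=; apply: le_trans (_ : _ <= Num.max (branch P S k z) 0) _.
  by rewrite le_max lexx.
by rewrite lerDl sumr_ge0// => j _; rewrite le_max lexx orbT.
Qed.

(** The triangle inequality for [x] and [- x] gives [2 N x >= N 0 = 0]. *)
Lemma is_norm_ge0 (R : realType) (n : nat) (N : 'rV[R]_n -> R) :
  is_norm N -> forall x, 0 <= N x.
Proof.
move=> [NT NZ _] x; have := NT x (- x); rewrite subrr.
have := NZ 0 x; have := NZ (-1) x.
by rewrite scale0r scaleN1r normrN1 normr0; lra.
Qed.

(** One half of the equivalence of norms, by expansion in the unit vectors. *)
Lemma is_norm_le (R : realType) (n : nat) (N : 'rV[R]_n -> R) :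
  is_norm N -> forall x, N x <= (\sum_i N (delta_mx 0 i)) * `|x|.
Proof.
move=> NN x; have [NT NZ _] := NN; rewrite [x in N x]row_sum_delta mulr_suml.
apply: (big_ind2 (fun y b => N y <= b)).
- by have := NZ 0 0; rewrite scale0r normr0 mul0r => ->.
- by move=> y b y' b' yb yb'; apply: le_trans (NT _ _) _; exact: lerD.
move=> i _; rewrite NZ mulrC ler_wpM2l ?is_norm_ge0//.
rewrite -[leRHS]/(mx_norm x) mx_normrE.
exact: (bigmax_sup (0, i)).
Qed.

Theorem theorem5p2 (R : realType) (n p q m : nat) (P : mpsc R n p q m)
    (N : 'rV[R]_n -> R) (zs : 'rV[R]_n) :
  is_norm N ->
  mpsc_C1 P ->
  feasible P zs ->
  directionally_quasi_normal P zs ->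
  local_error_bound P N zs.
Proof.
move=> NN PC1 zsF /(_ 0 (lin_cone0 P zs)) QN.
have /choice[a aP] := fun S => branch_error_bound S PC1 zsF QN.
pose C := \sum_i N (delta_mx 0 i); pose a1 := \sum_S a S.
have C0 : 0 <= C by rewrite sumr_ge0// => i _; exact: is_norm_ge0.
have a0 S : 0 <= a S by have [/ltW] := aP S.
(* The branch used below varies with [z], hence the bound on all branches at once. *)
pose V := [set z | forall S, exists2 y, feasible P y &
    `|z - y| <= a S * \sum_k Num.max (branch P S k z) 0].
have near_zs : nbhs zs V.
  by apply: (@filter_forall _ _ _ (nbhs zs)) => S; have [] := aP S.
(* The sum [a1] dominates every [a S]; the added 1 keeps the constant positive when [n = 0], where
   [C = 0]. *)
exists V, (C * a1 + 1); split; first exact: near_zs.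
  by rewrite ltr_wpDl// mulr_ge0// sumr_ge0.
move=> z /= zS.
pose S := [set i | `|Gfun P z 0 i| <= `|Hfun P z 0 i|]%SET.
have resS : \sum_k Num.max (branch P S k z) 0 = residual P z.
  rewrite sum_branch_violation; congr (_ + _); apply: eq_bigr => i _.
  by rewrite inE; case: leP.
have res0 : 0 <= residual P z.
  by rewrite -resS sumr_ge0// => k _; rewrite le_max lexx orbT.
have [y yF] := zS S; rewrite resS => yz.
have distle : dist N (feasible P) z <= N (z - y).
  apply: ge_inf; last by exists y.
  by exists 0 => _ [w _ <-]; exact: is_norm_ge0.
apply: (le_trans distle); apply: le_trans (is_norm_le NN _) _.
apply: (@le_trans _ _ (C * a1 * residual P z)); last first.
  by rewrite ler_wpM2r// lerDl.
rewrite -mulrA ler_wpM2l// (le_trans yz)// ler_wpM2r//.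
by rewrite /a1 (bigD1 S)//= lerDl sumr_ge0.
Qed.
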